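(* The following hold (where $\mathcal M\le\mathcal N$ means there is a minion homomorphism $\mathcal M\to\mathcal N$): $\mathcal D_\infty\le\mathcal C_\infty\le\mathcal B_\infty$; $\mathcal B_\infty\le\mathcal B_k$ for all $k\in\mathbb N$; $\mathcal B_{k+1}\le\mathcal A_{k+1}\le\mathcal B_k\le\mathcal A_k\le\mathcal T$ for all $k\in\mathbb N$; $\mathcal C_\infty\le\mathcal C_k$ for all $k\ge 2$; $\mathcal C_{k+1}\le\mathcal D_k\le\mathcal C_k$ for all $k\ge2$, and $\mathcal C_2\le\mathcal D_1$; $\mathcal C_{k+1}\le\mathcal B_k$ and $\mathcal D_k\le\mathcal A_k$ for all $k\in\mathbb N$.
   Context: A minion homomorphism between sets of multisorted operations closed under minors is a family of arity-preserving maps $\xi^{(n)}$ with $\xi(\mathbf f^{(\alpha)})=\xi(\mathbf f)^{(\alpha)}$, where $f^{(\alpha)}_i(a_1,\dots,a_m)=f_i(a_{\alpha(1)},\dots,a_{\alpha(n)})$ for $\alpha:[n]\to[m]$. $\mathcal T$ is the clone of all operations on a one-element set. For $n$-ary Boolean $f,g$: $f\le g$ pointwise; $f\triangleleft g$ iff $f(\mathbf a)\le g(\mathbf b)$ whenever $\mathbf a\le\mathbf b$; $f^d(\mathbf a)=1-f(\overline{\mathbf a})$. $\mathcal I_k$ is the set of $k$-tuples of $n$-ary idempotent Boolean operations ($n\in\mathbb N$). Chains mean consecutive relations hold. $\mathcal A_k=\{\mathbf h\in\mathcal I_k: h_1\triangleleft\dots\triangleleft h_k\le h_k^d\}$; $\mathcal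 B_k=\{\mathbf h\in\mathcal I_k: h_1\triangleleft\dots\triangleleft h_k\triangleleft h_k^d\}$; $\mathcal C_k=\{\mathbf h\in\mathcal I_k: h_1\triangleleft\dots\triangleleft h_{k-1}\le h_k=h_k^d,\ h_{k-1}\triangleleft h_{k-1}^d\}$ ($k\ge2$); $\mathcal D_k=\{\mathbf h\in\mathcal I_k: h_1\triangleleft\dots\triangleleft h_k=h_k^d\}$; $\mathcal B_\infty=\{(h)\in\mathcal I_1: h\triangleleft h\triangleleft h^d\}$; $\mathcal C_\infty=\{(h_1,h_2)\in\mathcal I_2: h_1\triangleleft h_1\triangleleft h_2=h_2^d\}$; $\mathcal D_\infty=\{(h)\in\mathcal I_1: h\triangleleft h=h^d\}$. *)

(* Defs.v *)
From mathcomp Require Import all_boot all_order.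

Set Implicit Arguments.
Unset Strict Implicit.
Unset Printing Implicit Defensive.

Import Order.TTheory.

Definition op (k : nat) (A : 'I_k -> Type) (n : nat) : Type :=
  forall s : 'I_k, ('I_n -> A s) -> A s.

Definition minor (k : nat) (A : 'I_k -> Type) (n m : nat)
    (alpha : 'I_n -> 'I_m) (f : op A n) : op A m :=
  fun s a => f s (a \o alpha).
Arguments minor {k A n m} alpha f s a.

Record minion (k : nat) (A : 'I_k -> Type) := Minion {
  minion_mem :> forall n : nat, op A n -> Prop;
  minion_minor : forall (n m : nat) (alpha : 'I_n -> 'I_m) (f : op A n),
    @minion_mem n f -> @minion_mem m (minor alpha f)
}.

Definition elt (k : nat) (A : 'I_k -> Type) (M : minion A) (n : nat) : Type :=
  {f : op A n | M n f}.

Definition elt_minor (k : nat) (A : 'I_k -> Type) (M : minion A) (n m : nat)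
    (alpha : 'I_n -> 'I_m) (f : elt M n) : elt M m :=
  exist _ (minor alpha (sval f)) (minion_minor alpha (svalP f)).

(* Equality is imposed on the underlying operations, so that membership proofs
   play no role. *)
Definition minion_hom (k l : nat) (A : 'I_k -> Type) (B : 'I_l -> Type)
    (M : minion A) (N : minion B) (xi : forall n : nat, elt M n -> elt N n) :
    Prop :=
  forall (n m : nat) (alpha : 'I_n -> 'I_m) (f : elt M n),
    sval (xi m (elt_minor alpha f)) = sval (elt_minor alpha (xi n f)).

Definition minion_le (k l : nat) (A : 'I_k -> Type) (B : 'I_l -> Type)
    (M : minion A) (N : minion B) : Prop :=
  exists xi : forall n : nat, elt M n -> elt N n, minion_hom xi.

Lemma mT_minor (n m : nat) (alpha : 'I_n -> 'I_m) : 0 < n -> 0 < m.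
Proof. by move=> n0; apply: leq_ltn_trans (ltn_ord (alpha (Ordinal n0))). Qed.

(* Arities are positive.  The Boolean minions below need no such restriction:
   there is no idempotent nullary operation. *)
Definition mT : minion (fun _ : 'I_1 => unit) :=
  @Minion 1 (fun _ => unit) (fun n _ => 0 < n)
    (fun n m alpha _ => mT_minor alpha).

Definition bop (n : nat) : Type := ('I_n -> bool) -> bool.

Definition bop_le (n : nat) (f g : bop n) : Prop :=
  forall a : 'I_n -> bool, (f a <= g a)%O.

Definition bop_tri (n : nat) (f g : bop n) : Prop :=
  forall a b : 'I_n -> bool, (forall i, (a i <= b i)%O) -> (f a <= g b)%O.

Definition bop_dual (n : nat) (f : bop n) : bop n :=
  fun a => ~~ f (fun i => ~~ a i).

Definition bop_idem (n : nat) (f : bop n) : Prop :=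
  forall x : bool, f (fun _ => x) = x.

(* [h : bops k n] is a [k]-tuple of [n]-ary Boolean operations.  Positions are
   0-based: the operation written h_{i+1} on paper is [h i]. *)
Definition bools (k : nat) : 'I_k -> Type := fun _ => bool.
Notation bops k n := (op (@bools k) n).

Definition bops_idem (k n : nat) (h : bops k n) : Prop :=
  forall i : 'I_k, bop_idem (h i).

(* h_1 <| h_2 <| ... <| h_l, for l <= k *)
Definition bops_chain (k n : nat) (h : bops k n) (l : nat) : Prop :=
  forall i j : 'I_k, j = i.+1 :> nat -> j < l -> bop_tri (h i) (h j).

(* In each condition the index [i] with [i.+1 = k] (resp. [i.+2 = k]) is the
   position of h_k (resp. h_{k-1}).  The families A, B and D are meant for
   [0 < k], and C for [1 < k]. *)

Definition inA (k n : nat) (h : bops k n) : Prop :=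
  [/\ bops_idem h, bops_chain h k
    & forall i : 'I_k, i.+1 = k -> bop_le (h i) (bop_dual (h i))].

Definition inB (k n : nat) (h : bops k n) : Prop :=
  [/\ bops_idem h, bops_chain h k
    & forall i : 'I_k, i.+1 = k -> bop_tri (h i) (bop_dual (h i))].

Definition inC (k n : nat) (h : bops k n) : Prop :=
  [/\ bops_idem h, bops_chain h k.-1
    & forall i j : 'I_k, i.+2 = k -> j.+1 = k ->
      [/\ bop_le (h i) (h j), h j = bop_dual (h j)
        & bop_tri (h i) (bop_dual (h i))]].

Definition inD (k n : nat) (h : bops k n) : Prop :=
  [/\ bops_idem h, bops_chain h k
    & forall i : 'I_k, i.+1 = k -> h i = bop_dual (h i)].

Definition inBoo (n : nat) (h : bops 1 n) : Prop :=
  [/\ bops_idem h, bop_tri (h ord0) (h ord0)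
    & bop_tri (h ord0) (bop_dual (h ord0))].

Definition inCoo (n : nat) (h : bops 2 n) : Prop :=
  [/\ bops_idem h, bop_tri (h ord0) (h ord0), bop_tri (h ord0) (h ord_max)
    & h ord_max = bop_dual (h ord_max)].

Definition inDoo (n : nat) (h : bops 1 n) : Prop :=
  [/\ bops_idem h, bop_tri (h ord0) (h ord0)
    & h ord0 = bop_dual (h ord0)].

Section MinorClosed.
Variables (k n m : nat) (alpha : 'I_n -> 'I_m).
Implicit Types (h : bops k n) (i j : 'I_k).

Lemma idem_minor h : bops_idem h -> bops_idem (minor alpha h).
Proof. by move=> hP i x; exact: (hP i x). Qed.

Lemma le_minor h i j : bop_le (h i) (h j) ->
  bop_le (minor alpha h i) (minor alpha h j).
Proof. by move=> hP a; exact: hP. Qed.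

Lemma le_dual_minor h i : bop_le (h i) (bop_dual (h i)) ->
  bop_le (minor alpha h i) (bop_dual (minor alpha h i)).
Proof. by move=> hP a; exact: (hP (a \o alpha)). Qed.

Lemma tri_minor h i j : bop_tri (h i) (h j) ->
  bop_tri (minor alpha h i) (minor alpha h j).
Proof. by move=> hP a b ab; apply: hP => x; exact: ab. Qed.

Lemma tri_dual_minor h i : bop_tri (h i) (bop_dual (h i)) ->
  bop_tri (minor alpha h i) (bop_dual (minor alpha h i)).
Proof.
by move=> hP a b ab; apply: (hP (a \o alpha) (b \o alpha)) => x; exact: ab.
Qed.

Lemma dual_minor h i : h i = bop_dual (h i) ->
  minor alpha h i = bop_dual (minor alpha h i).
Proof. exact: (congr1 (fun (f : bop n) a => f (a \o alpha))). Qed.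

Lemma chain_minor h l : bops_chain h l -> bops_chain (minor alpha h) l.
Proof. by move=> hP i j ij jl; apply: tri_minor; exact: hP. Qed.

End MinorClosed.

Lemma inA_minor (k n m : nat) (alpha : 'I_n -> 'I_m) (h : bops k n) :
  inA h -> inA (minor alpha h).
Proof.
move=> [hI hC hL]; split; [exact: idem_minor|exact: chain_minor|].
by move=> i ik; apply: le_dual_minor; exact: hL.
Qed.

Lemma inB_minor (k n m : nat) (alpha : 'I_n -> 'I_m) (h : bops k n) :
  inB h -> inB (minor alpha h).
Proof.
move=> [hI hC hL]; split; [exact: idem_minor|exact: chain_minor|].
by move=> i ik; apply: tri_dual_minor; exact: hL.
Qed.

Lemma inC_minor (k n m : nat) (alpha : 'I_n -> 'I_m) (h : bops k n) :
  inC h -> inC (minor alpha h).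
Proof.
move=> [hI hC hL]; split; [exact: idem_minor|exact: chain_minor|].
move=> i j ik jk; have [h1 h2 h3] := hL i j ik jk.
by split; [exact: le_minor|exact: dual_minor|exact: tri_dual_minor].
Qed.

Lemma inD_minor (k n m : nat) (alpha : 'I_n -> 'I_m) (h : bops k n) :
  inD h -> inD (minor alpha h).
Proof.
move=> [hI hC hL]; split; [exact: idem_minor|exact: chain_minor|].
by move=> i ik; apply: dual_minor; exact: hL.
Qed.

Lemma inBoo_minor (n m : nat) (alpha : 'I_n -> 'I_m) (h : bops 1 n) :
  inBoo h -> inBoo (minor alpha h).
Proof.
move=> [h1 h2 h3].
by split; [exact: idem_minor|exact: tri_minor|exact: tri_dual_minor].
Qed.

Lemma inCoo_minor (n m : nat) (alpha : 'I_n -> 'I_m) (h : bops 2 n) :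
  inCoo h -> inCoo (minor alpha h).
Proof.
move=> [h1 h2 h3 h4].
by split; [exact: idem_minor|exact: tri_minor|exact: tri_minor
          |exact: dual_minor].
Qed.

Lemma inDoo_minor (n m : nat) (alpha : 'I_n -> 'I_m) (h : bops 1 n) :
  inDoo h -> inDoo (minor alpha h).
Proof.
move=> [h1 h2 h3].
by split; [exact: idem_minor|exact: tri_minor|exact: dual_minor].
Qed.

Definition mA (k : nat) : minion (@bools k) := Minion (@inA_minor k).
Definition mB (k : nat) : minion (@bools k) := Minion (@inB_minor k).
Definition mC (k : nat) : minion (@bools k) := Minion (@inC_minor k).
Definition mD (k : nat) : minion (@bools k) := Minion (@inD_minor k).
Definition mBoo : minion (@bools 1) := Minion inBoo_minor.
Definition mCoo : minion (@bools 2) := Minion inCoo_minor.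
Definition mDoo : minion (@bools 1) := Minion inDoo_minor.

(* Main.v *)
(* Every homomorphism, apart from the constant one into [mT], selects (and
   possibly repeats) coordinates of the tuple, so it commutes with minors on the
   nose.  The target conditions follow from one observation: if [f <| g <= g^d]
   then [f <| f^d], because [g^d <= f^d]. *)
Require Import Defs.
From mathcomp Require Import all_boot all_order.
From mathcomp Require Import boolp.

Set Implicit Arguments.
Unset Strict Implicit.
Unset Printing Implicit Defensive.

Import Order.TTheory.

Lemma minion_le_reindex (k l : nat) (M : minion (@bools k))
    (N : minion (@bools l)) (sigma : 'I_l -> 'I_k) :
  (forall (n : nat) (h : bops k n), M n h -> N n (fun s => h (sigma s))) ->
  minion_le M N.
Proof.
move=> MN.
by exists (fun n f => exist _ (fun s => sval f (sigma s)) (MN n _ (svalP f))).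
Qed.

Section BooleanOperations.
Variable n : nat.
Implicit Types f g h : bop n.

Lemma bop_tri_le f g : bop_tri f g -> bop_le f g.
Proof. by move=> fg a; apply: fg. Qed.

Lemma bop_tri_le_trans f g h : bop_tri f g -> bop_le g h -> bop_tri f h.
Proof. by move=> fg gh a b ab; apply: le_trans (gh b); apply: fg. Qed.

Lemma bop_le_dual f g : bop_le f g -> bop_le (bop_dual g) (bop_dual f).
Proof.
move=> fg a; rewrite /bop_dual; have := fg (fun i => ~~ a i).
by case: (f _); case: (g _).
Qed.

Lemma bop_eq_le f g : f = g -> bop_le f g.
Proof. by move=> -> a. Qed.

Lemma bop_tri_dual f g :
  bop_tri f g -> bop_le g (bop_dual g) -> bop_tri f (bop_dual f).
Proof.
move=> fg gg; apply: bop_tri_le_trans (bop_le_dual (bop_tri_le fg)).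
exact: bop_tri_le_trans gg.
Qed.

(** With no arguments the two constant inputs are the same function, so idempotence would force
    [true = false]. This gives the positive arity that [mT] demands. *)
Lemma bop_idem_arity f : bop_idem f -> 0 < n.
Proof.
case: (posnP n) => // n0 fI.
have E : (fun _ : 'I_n => true) = (fun _ => false).
  by apply/funext => -[i ltin]; exfalso; move: ltin; rewrite n0.
by have := fI true; rewrite E fI.
Qed.

End BooleanOperations.

Lemma mDoo_mCoo : minion_le mDoo mCoo.
Proof.
apply: (minion_le_reindex (sigma := fun=> ord0)) => n h [hI hT hD].
by split=> // i; exact: hI.
Qed.

Lemma mCoo_mBoo : minion_le mCoo mBoo.
Proof.
apply: (minion_le_reindex (sigma := fun=> ord0)) => n h [hI h11 h12 hD].
by split=> [i||] //; apply: bop_tri_dual h12 (bop_eq_le hD).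
Qed.

(** One operation is repeated [k] times: [h <| h] supplies every link of the chain. *)
Lemma mBoo_mB (k : nat) : minion_le mBoo (mB k).
Proof.
apply: (minion_le_reindex (sigma := fun=> ord0)) => n h [hI hT hD].
by split=> i *; [exact: hI | exact: hT | exact: hD].
Qed.

Lemma mB_mA (k : nat) : minion_le (mB k) (mA k).
Proof.
apply: (minion_le_reindex (sigma := id)) => n h [hI hC hL].
by split=> // i ik; apply: bop_tri_le; exact: hL.
Qed.

Lemma mA_mB (k : nat) : minion_le (mA k.+1) (mB k).
Proof.
apply: (minion_le_reindex (sigma := widen_ord (leqnSn k))) => n h [hI hC hL].
split=> [i|i j ij jk|i ik]; [exact: hI| |].
  by apply: hC => //=; apply: ltnW.
(* The dropped operation h_{k+1} is the witness: h_k <| h_{k+1} <= h_{k+1}^d gives h_k <| h_k^d. *)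
by apply: (bop_tri_dual (g := h ord_max));
  [apply: hC => //=; rewrite ik | apply: hL].
Qed.

Lemma mA_mT (k : nat) : 0 < k -> minion_le (mA k) mT.
Proof.
move=> k0.
have arity n (f : elt (mA k) n) : mT n (fun _ _ => tt).
  (* [0 < k] provides a coordinate whose idempotence excludes arity zero. *)
  by case: f => h [hI _ _]; exact: bop_idem_arity (hI (Ordinal k0)).
by exists (fun n f => exist _ _ (arity n f)).
Qed.

Lemma mCoo_mC (k : nat) : minion_le mCoo (mC k).
Proof.
(* The image is (h_1, ..., h_1, h_2), with the self-dual operation only in the last place. *)
pose sigma (i : 'I_k) : 'I_2 := if i.+1 == k then ord_max else ord0.
apply: (minion_le_reindex (sigma := sigma)) => n h [hI h11 h12 hD].
have sigma0 (i : 'I_k) : i.+1 < k -> sigma i = ord0.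
  by move=> ik; rewrite /sigma ltn_eqF.
split=> [i|i j ij jk|i j ik jk]; first exact: hI.
  (* The chain required by [inC] stops at position k-1, so both of its indices select h_1. *)
  have jk' : j.+1 < k by rewrite -ltn_predRL.
  by rewrite !sigma0 // -ij ltnW.
have -> : sigma j = ord_max by rewrite /sigma jk eqxx.
rewrite sigma0; last exact: eq_leq.
by split=> //; [exact: bop_tri_le | exact: bop_tri_dual h12 (bop_eq_le hD)].
Qed.

(** The image is (h_1, ..., h_{k-1}, h_{k+1}): omitting h_k removes the one link that is only [<=]
    and keeps the self-dual end. *)
Lemma mC_mD (k : nat) : minion_le (mC k.+1) (mD k).
Proof.
pose sigma (i : 'I_k) : 'I_k.+1 :=
  if i.+1 == k then ord_max else widen_ord (leqnSn k) i.
apply: (minion_le_reindex (sigma := sigma)) => n h [hI hC hL].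
split=> [i|i j ij jk|i ik]; first exact: hI.
  have ij_tri : bop_tri (h (widen_ord (leqnSn k) i))
                        (h (widen_ord (leqnSn k) j)) by exact: hC.
  rewrite /sigma ltn_eqF -?ij //; case: eqP => // jk'.
  (* The new last link composes h_{k-1} <| h_k with h_k <= h_{k+1}. *)
  by apply: bop_tri_le_trans ij_tri _; case: (hL (widen_ord (leqnSn k) j) ord_max);
    rewrite //= jk'.
rewrite /sigma ik eqxx.
by case: (hL (widen_ord (leqnSn k) i) ord_max); rewrite //= ik.
Qed.

Lemma mD_mC (k : nat) : minion_le (mD k) (mC k).
Proof.
apply: (minion_le_reindex (sigma := id)) => n h [hI hC hL].
split=> [//|i j ij jk|i j ik jk]; first exact: hC.
have ij_tri : bop_tri (h i) (h j).
  by apply: hC => //; apply: succn_inj; rewrite jk ik.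
(* The last link h_{k-1} <| h_k weakens to [<=]; together with self-duality of h_k it also yields
   h_{k-1} <| h_{k-1}^d. *)
split; [exact: bop_tri_le | exact: hL |].
exact: bop_tri_dual ij_tri (bop_eq_le (hL j jk)).
Qed.

(** Dropping h_{k+1} suffices, since h_k <| h_k^d is already one of the conditions on the source
    tuple. *)
Lemma mC_mB (k : nat) : minion_le (mC k.+1) (mB k).
Proof.
apply: (minion_le_reindex (sigma := widen_ord (leqnSn k))) => n h [hI hC hL].
split=> [i|i j ij jk|i ik]; [exact: hI | exact: hC |].
by case: (hL (widen_ord (leqnSn k) i) ord_max); rewrite //= ik.
Qed.

Lemma mD_mA (k : nat) : minion_le (mD k) (mA k).
Proof.
apply: (minion_le_reindex (sigma := id)) => n h [hI hC hL].
by split=> // i ik; exact: bop_eq_le (hL i ik).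
Qed.

Theorem theorem4p15 :
  (minion_le mDoo mCoo /\ minion_le mCoo mBoo) /\
  (forall k : nat, 0 < k -> minion_le mBoo (mB k)) /\
  (forall k : nat, 0 < k ->
    [/\ minion_le (mB k.+1) (mA k.+1), minion_le (mA k.+1) (mB k),
        minion_le (mB k) (mA k) & minion_le (mA k) mT]) /\
  (forall k : nat, 2 <= k -> minion_le mCoo (mC k)) /\
  (forall k : nat, 2 <= k ->
    minion_le (mC k.+1) (mD k) /\ minion_le (mD k) (mC k)) /\
  minion_le (mC 2) (mD 1) /\
  (forall k : nat, 0 < k ->
    minion_le (mC k.+1) (mB k) /\ minion_le (mD k) (mA k)).
Proof.
split; first by split; [exact: mDoo_mCoo | exact: mCoo_mBoo].
split; first by move=> k _; exact: mBoo_mB.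
split.
  by move=> k k0; split;
    [exact: mB_mA | exact: mA_mB | exact: mB_mA | exact: mA_mT].
split; first by move=> k _; exact: mCoo_mC.
split; first by move=> k _; split; [exact: mC_mD | exact: mD_mC].
(* At [k = 1] the map keeps only the self-dual h_2 of the pair, and the target chain is empty. *)
split; first exact: mC_mD.
by move=> k _; split; [exact: mC_mB | exact: mD_mA].
Qed.
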